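(* Let $(N_m)_{m\ge0}$ be positive integers with $N_0=N$, and for each $m\ge1$ let $W_m:\mathbb{R}^{N_{m-1}}\to\mathbb{C}^{N_m}$ be linear with $W_m^*W_m=\mathrm{Id}$. Let $X$ be a random vector in $\mathbb{R}^N$ with $E(\|X\|^2)<\infty$, with expected scattering layers $(X_m)_{m\ge0}$. Let $X_1',\dots,X_P'$ be independent random vectors each having the same distribution as $X$. Define $\overline X_{i,0}=X_i'$ and, for $m\ge0$, $$\overline\mu_m=\frac1P\sum_{i=1}^P\overline X_{i,m},\qquad \overline X_{i,m+1}=|W_{m+1}(\overline X_{i,m}-\overline\mu_m)|.$$ Then for every $m\ge0$, $$E\big(\|\overline\mu_m-E(X_m)\|^2\big)\le \frac1P\Big(\sum_{n=0}^m\Big(\sum_{k=n+1}^\infty\|E(X_k)\|^2\Big)^{1/2}\Big)^2\le \frac{(m+1)^2}{P}\,E(\|X\|^2).$$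
   Context: For $z\in\mathbb{C}^n$, $|z|$ denotes the vector of coordinatewise complex moduli; $\|\cdot\|$ is the Euclidean norm. Expected scattering layers: $X_0=X$ and $X_{m+1}=|W_{m+1}(X_m-E(X_m))|\in\mathbb{R}^{N_{m+1}}$ for $m\ge0$. *)

(* Defs.v *)
From HB Require Import structures.
From mathcomp Require Import all_boot all_order all_algebra.
From mathcomp Require Import all_classical all_reals all_analysis.
Set Implicit Arguments. Unset Strict Implicit. Unset Printing Implicit Defensive.
Import Order.TTheory GRing.Theory Num.Theory.
Import numFieldNormedType.Exports.
Local Open Scope classical_set_scope.
Local Open Scope ring_scope.

Section defs.
Context {d : measure_display} {T : measurableType d} {R : realType}.

Definition sqnorm n (x : 'cV[R]_n) : R := \sum_(i < n) (x i 0) ^+ 2.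

(* A linear map W : R^n -> C^k is given by its real part Wre and its
   imaginary part Wim (real k x n matrices): W x = Wre x + i Wim x. *)
Definition cmodW k n (Wre Wim : 'M[R]_(k, n)) (x : 'cV[R]_n) : 'cV[R]_k :=
  \col_j Num.sqrt ((Wre *m x) j 0 ^+ 2 + (Wim *m x) j 0 ^+ 2).

(* W^* W = Id, the adjoint taken w.r.t. the real inner products
   <x,y> = x^T y on R^n and Re <u,v> on C^k *)
Definition isometric_W k n (Wre Wim : 'M[R]_(k, n)) : Prop :=
  Wre^T *m Wre + Wim^T *m Wim = 1%:M.

Definition random_vector (P : probability T R) n (X : T -> 'cV[R]_n) : Prop :=
  forall i : 'I_n, measurable_fun setT (fun w => X w i 0).

(* E(X), coordinatewise (finite under the hypotheses used below) *)
Definition Evec (P : probability T R) n (X : T -> 'cV[R]_n) : 'cV[R]_n :=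
  \col_i fine ('E_P[fun w => X w i 0]).

Definition borel_vec n : set (set 'cV[R]_n) :=
  <<s [set B | exists A : 'I_n -> set R,
         (forall i, measurable (A i)) /\ B = [set x : 'cV[R]_n | forall i, A i (x i 0)]] >>.

Definition same_distribution (P : probability T R) n (X Y : T -> 'cV[R]_n) : Prop :=
  forall B, borel_vec B -> P (X @^-1` B) = P (Y @^-1` B).

Definition independent_vecs (P : probability T R) n Pn
  (X : 'I_Pn -> T -> 'cV[R]_n) : Prop :=
  forall B : 'I_Pn -> set 'cV[R]_n, (forall i, borel_vec (B i)) ->
    P (\bigcap_(i in [set: 'I_Pn]) (X i @^-1` B i)) =
    (\prod_(i < Pn) P (X i @^-1` B i))%E.

(* expected scattering layers: X_0 = X, X_{m+1} = |W_{m+1}(X_m - E X_m)|;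
   Wre m, Wim m are the real/imaginary parts of W_{m+1} *)
Fixpoint layer (P : probability T R) (N : nat -> nat)
  (Wre Wim : forall m, 'M[R]_(N m.+1, N m)) (X : T -> 'cV[R]_(N 0%N)) (m : nat)
  : T -> 'cV[R]_(N m) :=
  match m with
  | 0%N => X
  | m'.+1 => fun w =>
      cmodW (Wre m') (Wim m')
        (layer P Wre Wim X m' w - Evec P (layer P Wre Wim X m'))
  end.

Fixpoint emp_layer (N : nat -> nat) (Wre Wim : forall m, 'M[R]_(N m.+1, N m))
  Pn (Xs : 'I_Pn -> T -> 'cV[R]_(N 0%N)) (m : nat) : 'I_Pn -> T -> 'cV[R]_(N m) :=
  match m with
  | 0%N => Xs
  | m'.+1 => fun i w =>
      cmodW (Wre m') (Wim m')
        (emp_layer Wre Wim Xs m' i w -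
         Pn%:R^-1 *: \sum_(j < Pn) emp_layer Wre Wim Xs m' j w)
  end.

Definition emp_mean (N : nat -> nat) (Wre Wim : forall m, 'M[R]_(N m.+1, N m))
  Pn (Xs : 'I_Pn -> T -> 'cV[R]_(N 0%N)) (m : nat) (w : T) : 'cV[R]_(N m) :=
  Pn%:R^-1 *: \sum_(j < Pn) emp_layer Wre Wim Xs m j w.

End defs.

(* Main.v *)
Require Import Defs.
From HB Require Import structures.
From mathcomp Require Import all_boot all_order all_algebra.
From mathcomp Require Import all_classical all_reals all_analysis.
From mathcomp Require Import measurable_realfun ring lra.
Import Order.TTheory GRing.Theory Num.Theory.
Import numFieldNormedType.Exports.
Local Open Scope classical_set_scope.
Local Open Scope ring_scope.
Set Implicit Arguments. Unset Strict Implicit. Unset Printing Implicit Defensive.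

(* Write s_m^2 = E|X_m - E X_m|^2.  Since |.| and W preserve norms,
   E|X_{m+1}|^2 = s_m^2, hence s_m^2 = |E X_{m+1}|^2 + s_{m+1}^2.  The tail
   sum over k > n of |E X_k|^2 therefore equals s_n^2 as soon as s_m tends
   to 0.  To see this, approximate X in L^2 by a vector taking finitely many
   values; X |-> X_m is an L^2 contraction, so it is enough to treat such
   vectors, and for them nonnegative coordinates give
   |E X_{m+1}|^2 >= p E|X_{m+1}|^2 with p the smallest positive mass, so that
   s_m^2 decreases geometrically.

   For the empirical layers, compare with Z_{i,m}, the layers of X'_i computed
   with the true expectations: they are i.i.d. copies of X_m, so the error b_m
   of their mean satisfies E|b_m|^2 = s_m^2 / P.  The average over i of
   |Xbar_{i,m} - Z_{i,m}|^2 increases by at most |b_m|^2 from one layer to the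
   next, and the bound follows from the triangle inequality in L^2. *)

(** * Euclidean norms, complex moduli and averages of vectors *)

Section vectors.
Context {R : realType}.
Implicit Types n k : nat.

Lemma sqnorm_ge0 n (x : 'cV[R]_n) : 0 <= sqnorm x.
Proof. by apply: sumr_ge0 => i _; exact: sqr_ge0. Qed.

Lemma sqnormE n (x : 'cV[R]_n) : sqnorm x = (x^T *m x) 0 0.
Proof. by rewrite mxE; apply: eq_bigr => i _; rewrite mxE expr2. Qed.

Lemma subvE n (x y : 'cV[R]_n) i : (x - y) i 0 = x i 0 - y i 0.
Proof. by rewrite !mxE. Qed.

Lemma coord_sqnorm n (x : 'cV[R]_n) i : x i 0 ^+ 2 <= sqnorm x.
Proof.
by rewrite /sqnorm (bigD1 i)//= lerDl sumr_ge0// => j _; exact: sqr_ge0.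
Qed.

(* [2 |<x, y>| <= t |x|^2 + t^-1 |y|^2], coordinatewise *)
Lemma sqnormD_le n (x y : 'cV[R]_n) t : 0 < t ->
  sqnorm (x + y) <= (1 + t) * sqnorm x + (1 + t^-1) * sqnorm y.
Proof.
move=> t0; rewrite /sqnorm !mulr_sumr -big_split/=; apply: ler_sum => i _.
rewrite mxE; set a := x i 0; set b := y i 0.
rewrite -subr_ge0.
have -> : (1 + t) * a ^+ 2 + (1 + t^-1) * b ^+ 2 - (a + b) ^+ 2 =
  t^-1 * (t * a - b) ^+ 2 by field; rewrite gt_eqF.
by rewrite mulr_ge0 ?sqr_ge0// invr_ge0 ltW.
Qed.

(** Both sides equal x^T W^* W x, by the isometry condition. *)
Lemma isometric_sqnorm k n (Wre Wim : 'M[R]_(k, n)) (x : 'cV[R]_n) :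
  isometric_W Wre Wim ->
  \sum_(j < k) ((Wre *m x) j 0 ^+ 2 + (Wim *m x) j 0 ^+ 2) = sqnorm x.
Proof.
move=> W1; rewrite big_split/= -!/(sqnorm _).
have -> : sqnorm x = (x^T *m (1%:M *m x)) 0 0 by rewrite mul1mx sqnormE.
by rewrite -W1 mulmxDl mulmxDr mxE !sqnormE !trmx_mul !mulmxA.
Qed.

Lemma sqnorm_cmodW k n (Wre Wim : 'M[R]_(k, n)) (x : 'cV[R]_n) :
  isometric_W Wre Wim -> sqnorm (cmodW Wre Wim x) = sqnorm x.
Proof.
move=> W1; rewrite -(isometric_sqnorm x W1); apply: eq_bigr => j _.
by rewrite mxE sqr_sqrtr// addr_ge0// sqr_ge0.
Qed.

(** This is the reverse triangle inequality for complex moduli: expanding the squares leaves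
    Cauchy-Schwarz in the plane, whose defect is the square of [a * e - b * c]. *)
Lemma sqr_modulusB_le (a b c e : R) :
  (Num.sqrt (a ^+ 2 + b ^+ 2) - Num.sqrt (c ^+ 2 + e ^+ 2)) ^+ 2 <=
  (a - c) ^+ 2 + (b - e) ^+ 2.
Proof.
have ab0 : 0 <= a ^+ 2 + b ^+ 2 by rewrite addr_ge0// sqr_ge0.
have ce0 : 0 <= c ^+ 2 + e ^+ 2 by rewrite addr_ge0// sqr_ge0.
rewrite sqrrB !sqr_sqrtr// -sqrtrM//.
suff : a * c + b * e <= Num.sqrt ((a ^+ 2 + b ^+ 2) * (c ^+ 2 + e ^+ 2)) by lra.
apply: le_trans (ler_norm _) _; rewrite -sqrtr_sqr ler_wsqrtr// -subr_ge0.
have -> : (a ^+ 2 + b ^+ 2) * (c ^+ 2 + e ^+ 2) - (a * c + b * e) ^+ 2 =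
  (a * e - b * c) ^+ 2 by ring.
exact: sqr_ge0.
Qed.

Lemma sqnorm_cmodWB k n (Wre Wim : 'M[R]_(k, n)) (x y : 'cV[R]_n) :
  isometric_W Wre Wim ->
  sqnorm (cmodW Wre Wim x - cmodW Wre Wim y) <= sqnorm (x - y).
Proof.
move=> W1; rewrite -(isometric_sqnorm (x - y) W1); apply: ler_sum => j _.
by rewrite !mulmxBr !mxE; exact: sqr_modulusB_le.
Qed.

Section average.
Variables (Pn n : nat) (a : 'I_Pn -> 'cV[R]_n).
Hypothesis Pn0 : (0 < Pn)%N.
Let avg := Pn%:R^-1 *: \sum_(i < Pn) a i.

Let Pn_neq0 : Pn%:R != 0 :> R. Proof. by rewrite pnatr_eq0 -lt0n. Qed.

(** The deviations from the average sum to zero, so the cross terms with [b] cancel; what is left is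
    the usual variance identity, shifted by [b]. *)
Lemma sum_sqnormB_avg (b : 'cV[R]_n) :
  \sum_(i < Pn) sqnorm (a i - avg - b) =
  \sum_(i < Pn) sqnorm (a i) - Pn%:R * sqnorm avg + Pn%:R * sqnorm b.
Proof.
rewrite [LHS]exchange_big [in RHS]exchange_big/= /sqnorm !mulr_sumr -sumrB -big_split/=.
apply: eq_bigr => j _.
have avgE : \sum_(i < Pn) a i j 0 = Pn%:R * avg j 0.
  by rewrite /avg mxE summxE mulrA divff// mul1r.
transitivity (\sum_(i < Pn) (a i j 0 ^+ 2
    + (- 2 * (avg j 0 + b j 0)) * a i j 0 + (avg j 0 + b j 0) ^+ 2)).
  by apply: eq_bigr => i _; rewrite !mxE; ring.
rewrite !big_split/= -mulr_sumr avgE sumr_const card_ord -mulr_natl; ring.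
Qed.

Lemma sqnorm_avg_le : sqnorm avg <= Pn%:R^-1 * \sum_(i < Pn) sqnorm (a i).
Proof.
have := sum_sqnormB_avg 0; rewrite (_ : sqnorm (0 : 'cV[R]_n) = 0); last first.
  by rewrite /sqnorm big1// => i _; rewrite mxE expr0n.
rewrite mulr0 addr0 => /esym h.
have : 0 <= \sum_(i < Pn) sqnorm (a i - avg - 0).
  by apply: sumr_ge0 => i _; exact: sqnorm_ge0.
by rewrite -h subr_ge0 ler_pdivlMl ?ltr0n.
Qed.

End average.

End vectors.

(** * Square-integrable random variables and vectors *)

Section square_integrable.
Context {d : measure_display} {T : measurableType d} {R : realType}.
Variable P : probability T R.
Implicit Types f g : T -> R.

Notation intble f := (P.-integrable setT (EFin \o f)).
Notation Ex f := (Rintegral P setT f).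

Lemma intble_le f g : measurable_fun setT f ->
  (forall w, `|f w| <= g w) -> intble g -> intble f.
Proof.
move=> mf fg; apply: le_integrable => //; first exact/measurable_EFinP.
by move=> w _; rewrite /= lee_fin (le_trans (fg w))// ler_norm.
Qed.

Lemma intbleD f g : intble f -> intble g -> intble (fun w => f w + g w).
Proof. by move=> fi gi; exact: (integrableD measurableT fi gi). Qed.

Lemma intbleZ a f : intble f -> intble (fun w => a * f w).
Proof. by move=> fi; exact: (integrableZl measurableT a fi). Qed.

Lemma intble_sum (I : Type) (s : seq I) (Q : pred I) (h : I -> T -> R) :
  (forall i, Q i -> intble (h i)) -> intble (fun w => \sum_(i <- s | Q i) h i w).
Proof.
move=> hi; rewrite (_ : _ \o _ = fun w => (\sum_(i <- s | Q i) (h i w)%:E)%E).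
  by apply: integrable_sum.
by apply/funext => w /=; rewrite sumEFin.
Qed.

Lemma intble_cst a : intble (fun=> a).
Proof. exact: finite_measure_integrable_cst. Qed.

Lemma Ex_cst a : Ex (fun=> a) = a.
Proof.
rewrite Rintegral_cst//.
have -> : fine (P setT) = 1 by rewrite probability_setT.
by rewrite mulr1.
Qed.

Lemma Ex_sum (I : Type) (s : seq I) (Q : pred I) (h : I -> T -> R) :
  (forall i, Q i -> intble (h i)) ->
  Ex (fun w => \sum_(i <- s | Q i) h i w) = \sum_(i <- s | Q i) Ex (h i).
Proof.
move=> hi; elim: s => [|i s ih].
  by rewrite big_nil -[RHS](Ex_cst 0); apply: eq_Rintegral => w _; rewrite big_nil.
rewrite big_cons -ih; case: ifPn => Qi; last first.
  by apply: eq_Rintegral => w _; rewrite big_cons (negbTE Qi).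
rewrite -RintegralD//; [|exact: hi|exact: intble_sum].
by apply: eq_Rintegral => w _; rewrite big_cons Qi.
Qed.

Lemma expectation_EFin f : intble f -> ('E_P[f] = (Ex f)%:E)%E.
Proof. by move=> fi; rewrite unlock fineK//; exact: integrable_fin_num. Qed.

(** Membership in L^2. Measurability is a separate clause because that of the square does not give
    that of [f]. *)
Definition sqint f := measurable_fun setT f /\ intble (fun w => f w ^+ 2).

Lemma sqint_ext f g : f =1 g -> sqint f -> sqint g.
Proof. by move=> /funext ->. Qed.

Lemma sqintM f g : sqint f -> sqint g -> intble (fun w => f w * g w).
Proof.
move=> [mf f2] [mg g2]; apply: intble_le (intbleD f2 g2).
  exact: measurable_funM.
move=> w; rewrite normrM -(real_normK (num_real (f w))) -(real_normK (num_real (g w))).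
have := sqr_ge0 (`|f w| - `|g w|); have := mulr_ge0 (normr_ge0 (f w)) (normr_ge0 (g w)).
nra.
Qed.

Lemma sqint_cst a : sqint (fun=> a).
Proof. by split => //; exact: intble_cst. Qed.

Lemma sqint_int f : sqint f -> intble f.
Proof.
move=> /sqintM/(_ (sqint_cst 1)).
by under [X in integrable _ _ X -> _]eq_fun do rewrite /= mulr1.
Qed.

Lemma sqintD f g : sqint f -> sqint g -> sqint (fun w => f w + g w).
Proof.
move=> sf sg; split; first by apply: measurable_funD; [case: sf|case: sg].
have := intbleD (intbleD sf.2 sg.2) (intbleZ 2 (sqintM sf sg)).
by apply: eq_integrable => // w _ /=; congr EFin; ring.
Qed.

Lemma sqintZ a f : sqint f -> sqint (fun w => a * f w).
Proof.
move=> [mf f2]; split; first exact: measurable_funM.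
by have := intbleZ (a ^+ 2) f2; apply: eq_integrable => // w _ /=; rewrite exprMn.
Qed.

Lemma sqint_sum (I : Type) (s : seq I) (Q : pred I) (h : I -> T -> R) :
  (forall i, Q i -> sqint (h i)) -> sqint (fun w => \sum_(i <- s | Q i) h i w).
Proof.
move=> hi; elim: s => [|i s ih].
  by apply: sqint_ext (sqint_cst 0) => w; rewrite big_nil.
case: (boolP (Q i)) => Qi.
  by apply: sqint_ext (sqintD (hi _ Qi) ih) => w; rewrite big_cons Qi.
by apply: sqint_ext ih => w; rewrite big_cons (negbTE Qi).
Qed.

Lemma sqint_variance f : sqint f ->
  Ex (fun w => (f w - Ex f) ^+ 2) = Ex (fun w => f w ^+ 2) - Ex f ^+ 2.
Proof.
move=> sf; set c := Ex f.
transitivity (Ex (fun w => f w ^+ 2 + (- 2 * c * f w + c ^+ 2))).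
  by apply: eq_Rintegral => w _; ring.
have [fi f2] := (sqint_int sf, sf.2).
rewrite !RintegralD//; [|exact: intbleZ|exact: intble_cst|apply: intbleD].
- by rewrite RintegralZl// Ex_cst -/c; ring.
- exact: intbleZ.
- exact: intble_cst.
Qed.

Section vect.
Variable n : nat.
Implicit Types X Y : T -> 'cV[R]_n.

Definition sqintv X := forall i, sqint (fun w => X w i 0).

Lemma sqintv_cst c : sqintv (fun=> c).
Proof. by move=> i; exact: sqint_cst. Qed.

Lemma sqintvD X Y : sqintv X -> sqintv Y -> sqintv (fun w => X w + Y w).
Proof.
by move=> sX sY i; apply: sqint_ext (sqintD (sX i) (sY i)) => w; rewrite mxE.
Qed.

Lemma sqintvZ a X : sqintv X -> sqintv (fun w => a *: X w).
Proof. by move=> sX i; apply: sqint_ext (sqintZ a (sX i)) => w; rewrite mxE. Qed.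

Lemma sqintvB X Y : sqintv X -> sqintv Y -> sqintv (fun w => X w - Y w).
Proof.
move=> sX sY; have := sqintvD sX (sqintvZ (-1) sY).
by congr sqintv; apply/funext => w; rewrite scaleN1r.
Qed.

Lemma sqintv_sum (I : Type) (s : seq I) (Q : pred I) (h : I -> T -> 'cV[R]_n) :
  (forall i, Q i -> sqintv (h i)) -> sqintv (fun w => \sum_(i <- s | Q i) h i w).
Proof.
move=> hi j; have := @sqint_sum I s Q (fun i w => h i w j 0).
move=> /(_ (fun i Qi => hi i Qi j)); apply: sqint_ext => w.
by rewrite summxE.
Qed.

Lemma sqnorm_int X : sqintv X -> intble (fun w => sqnorm (X w)).
Proof. by move=> sX; apply: intble_sum => i _; exact: (sX i).2. Qed.

Lemma Ex_sqnorm X : sqintv X ->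
  Ex (fun w => sqnorm (X w)) = \sum_(i < n) Ex (fun w => X w i 0 ^+ 2).
Proof. by move=> sX; apply: Ex_sum => i _; exact: (sX i).2. Qed.

Lemma EvecE X i : Evec P X i 0 = Ex (fun w => X w i 0).
Proof. by rewrite mxE unlock. Qed.

Lemma EvecB X Y : sqintv X -> sqintv Y ->
  Evec P (fun w => X w - Y w) = Evec P X - Evec P Y.
Proof.
move=> sX sY; apply/colP => i; rewrite subvE !EvecE.
rewrite -RintegralB//; [|exact: sqint_int (sX i)|exact: sqint_int (sY i)].
by apply: eq_Rintegral => w _; rewrite subvE.
Qed.

(** The trace of the covariance matrix of [X]. *)
Definition Evar X := Ex (fun w => sqnorm (X w - Evec P X)).

Lemma sqintv_center X : sqintv X -> sqintv (fun w => X w - Evec P X).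
Proof. by move=> sX; apply: sqintvB => //; exact: sqintv_cst. Qed.

Lemma Evar_ge0 X : 0 <= Evar X.
Proof. by apply: Rintegral_ge0 => w _; exact: sqnorm_ge0. Qed.

Lemma EvarE X : sqintv X ->
  Evar X = Ex (fun w => sqnorm (X w)) - sqnorm (Evec P X).
Proof.
move=> sX; rewrite /Evar Ex_sqnorm ?Ex_sqnorm//; last exact: sqintv_center.
rewrite -sumrB; apply: eq_bigr => i _; rewrite EvecE -sqint_variance//.
by apply: eq_Rintegral => w _; rewrite -EvecE subvE.
Qed.

Lemma Evar_le X : sqintv X -> Evar X <= Ex (fun w => sqnorm (X w)).
Proof. by move=> sX; rewrite EvarE// gerBl sqnorm_ge0. Qed.

End vect.

End square_integrable.

(** * Measurability through a linear map and a modulus *)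

Lemma measurable_mulmx {d : measure_display} {T : measurableType d}
    {R : realType} k n (A : 'M[R]_(k, n)) (X : T -> 'cV[R]_n) :
  (forall i, measurable_fun setT (fun w => X w i 0)) ->
  forall j, measurable_fun setT (fun w => (A *m X w) j 0).
Proof.
move=> mX j; under eq_fun do rewrite mxE.
by apply: measurable_sum => i; exact: measurable_funM.
Qed.

Lemma measurable_cmodW {d : measure_display} {T : measurableType d}
    {R : realType} k n (Wre Wim : 'M[R]_(k, n)) (X : T -> 'cV[R]_n) :
  (forall i, measurable_fun setT (fun w => X w i 0)) ->
  forall j, measurable_fun setT (fun w => cmodW Wre Wim (X w) j 0).
Proof.
move=> mX j; under eq_fun do rewrite mxE.
apply: (measurableT_comp (continuous_measurable_fun (@sqrt_continuous R))).
by apply: measurable_funD; apply: measurable_funX; exact: measurable_mulmx.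
Qed.

(** * Energy balance and contraction of the expected layers *)

Section scattering.
Context {d : measure_display} {T : measurableType d} {R : realType}.
Variable P : probability T R.

Notation Ex f := (Rintegral P setT f).

Lemma sqintv_mulmx k n (A : 'M[R]_(k, n)) (X : T -> 'cV[R]_n) :
  sqintv P X -> sqintv P (fun w => A *m X w).
Proof.
move=> sX j; apply: (@sqint_ext _ _ _ _ (fun w => \sum_i A j i * X w i 0)).
  by move=> w; rewrite mxE.
by apply: sqint_sum => i _; exact: sqintZ.
Qed.

Lemma sqintv_cmodW k n (Wre Wim : 'M[R]_(k, n)) (X : T -> 'cV[R]_n) :
  sqintv P X -> sqintv P (fun w => cmodW Wre Wim (X w)).
Proof.
move=> sX j; split; first by apply: measurable_cmodW => i; exact: (sX i).1.
have := intbleD (sqintv_mulmx Wre sX j).2 (sqintv_mulmx Wim sX j).2.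
apply: eq_integrable => // w _ /=; congr EFin.
by rewrite [in RHS]mxE sqr_sqrtr// addr_ge0// sqr_ge0.
Qed.

Variables (N : nat -> nat) (Wre Wim : forall m, 'M[R]_(N m.+1, N m)).
Hypothesis W_isometric : forall m, isometric_W (Wre m) (Wim m).

Notation layer := (layer P Wre Wim).

Lemma sqintv_layer X m : sqintv P X -> sqintv P (layer X m).
Proof.
by move=> sX; elim: m => //= m ih; apply: sqintv_cmodW; exact: sqintv_center.
Qed.
Arguments sqintv_layer {X} m _.

Lemma Ex_sqnorm_layerS X m :
  Ex (fun w => sqnorm (layer X m.+1 w)) = Evar P (layer X m).
Proof. by apply: eq_Rintegral => w _; rewrite /= sqnorm_cmodW. Qed.

Lemma Evar_layerS X m : sqintv P X ->
  Evar P (layer X m) =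
  sqnorm (Evec P (layer X m.+1)) + Evar P (layer X m.+1).
Proof.
by move=> sX; rewrite [in RHS]EvarE; [rewrite Ex_sqnorm_layerS; ring|exact: sqintv_layer].
Qed.

(** Centring is linear and does not increase the L^2 norm, and the modulus of an isometry is
    nonexpansive, so no layer increases the distance. *)
Lemma layerB_contraction X Y m : sqintv P X -> sqintv P Y ->
  Ex (fun w => sqnorm (layer X m w - layer Y m w)) <=
  Ex (fun w => sqnorm (X w - Y w)).
Proof.
move=> sX sY; elim: m => [//|m]; apply: le_trans.
have [sXm sYm] := (sqintv_layer m sX, sqintv_layer m sY).
apply: le_trans (Evar_le (sqintvB sXm sYm)).
apply: le_Rintegral => //.
- by apply: sqnorm_int; apply: sqintvB; exact: (sqintv_layer m.+1).
- by apply: sqnorm_int; apply: sqintv_center; exact: sqintvB.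
move=> w _; apply: le_trans (sqnorm_cmodWB _ _ _) _ => //.
by rewrite EvecB// (opprD (layer Y m w)) addrACA -opprD.
Qed.

(** * Random vectors that depend on a finite label only *)

Section finite_label.
Variables (I : finType) (K : T -> I).
Hypothesis mK : forall i, measurable (K @^-1` [set i]).

Let q i := Ex (\1_(K @^-1` [set i]) : T -> R).

Lemma finite_labelE (g : I -> R) w :
  g (K w) = \sum_i g i * \1_(K @^-1` [set i]) w.
Proof.
rewrite (bigD1 (K w))//= indicE mem_set// mulr1 big1 ?addr0// => i /eqP iK.
by rewrite indicE memNset ?mulr0// => /esym.
Qed.

Lemma sqint_finite_label (g : I -> R) : sqint P (fun w => g (K w)).
Proof.
apply: (@sqint_ext _ _ _ _ (fun w => \sum_i g i * \1_(K @^-1` [set i]) w)).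
  by move=> w; rewrite -finite_labelE.
apply: sqint_sum => i _; apply: sqintZ; split; first exact: measurable_indic.
apply: (intble_le _ _ (intble_cst P 1)).
  by apply: measurable_funX; exact: measurable_indic.
by move=> w; rewrite indicE normrX normr_nat; case: (_ \in _); rewrite ?expr1n ?expr0n.
Qed.

Lemma Ex_finite_label (g : I -> R) : Ex (fun w => g (K w)) = \sum_i g i * q i.
Proof.
have indi i : P.-integrable setT (EFin \o (\1_(K @^-1` [set i]) : T -> R)).
  exact: integrable_indic.
transitivity (Ex (fun w => \sum_i g i * \1_(K @^-1` [set i]) w)).
  by apply: eq_Rintegral => w _; exact: finite_labelE.
by rewrite Ex_sum => [|i _]; [apply: eq_bigr => i _; rewrite RintegralZl|exact: intbleZ].
Qed.

(** The smallest nonzero mass works; the default 1 of the minimum also yields [p <= 1]. *)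
Lemma finite_label_mass : exists2 p : R, 0 < p <= 1 &
  forall i, q i = 0 \/ p <= q i.
Proof.
have q0 i : 0 <= q i by apply: Rintegral_ge0 => w _; exact: ler0n.
exists (\big[Order.min/1]_(i | q i != 0) q i).
  rewrite bigmin_le_id andbT; apply/bigmin_gtP; split => // i qi.
  by rewrite lt_def qi q0.
by move=> i; have [->|qi] := eqVneq (q i) 0; [left|right; exact: bigmin_le_cond].
Qed.

(* [sum_i (q_i f_i)^2 <= (sum_i q_i f_i)^2] for nonnegative terms *)
Lemma finite_label_energy : exists2 p : R, 0 < p <= 1 &
  forall n (f : I -> 'cV[R]_n), (forall i j, 0 <= f i j 0) ->
  p * Ex (fun w => sqnorm (f (K w))) <= sqnorm (Evec P (fun w => f (K w))).
Proof.
have [p p01 pq] := finite_label_mass; exists p => // n f f0.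
have q0 i : 0 <= q i by apply: Rintegral_ge0 => w _; exact: ler0n.
rewrite Ex_sqnorm; last by move=> j; exact: (sqint_finite_label (fun i => f i j 0)).
rewrite mulr_sumr; apply: ler_sum => j _; rewrite EvecE.
rewrite (Ex_finite_label (fun i => f i j 0 ^+ 2)) (Ex_finite_label (fun i => f i j 0)).
(* Each mass satisfies [p * q i <= q i ^+ 2], trivially when it vanishes; nonnegativity of the
   entries then lets the cross terms of the squared sum be dropped. *)
apply: (@le_trans _ _ (\sum_i (f i j 0 * q i) ^+ 2)).
  rewrite mulr_sumr; apply: ler_sum => i _; rewrite exprMn mulrCA.
  rewrite ler_wpM2l ?sqr_ge0// expr2.
  by have [->|pqi] := pq i; rewrite ?mulr0// ler_wpM2r.
have fq0 i : 0 <= f i j 0 * q i by rewrite mulr_ge0.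
rewrite [leRHS]expr2 mulr_suml; apply: ler_sum => i _.
by rewrite expr2 ler_wpM2l// (bigD1 i)//= lerDl sumr_ge0.
Qed.

(** The expectations subtracted are constants, so every layer remains a function of the one label
    [K]. This keeps the rate [p] the same at all depths. *)
Lemma finite_label_layer (f : I -> 'cV[R]_(N 0%N)) m :
  exists g : I -> 'cV[R]_(N m), layer (fun w => f (K w)) m = g \o K.
Proof.
elim: m => [|m [g gE]]; first by exists f.
exists (fun i => cmodW (Wre m) (Wim m) (g i - Evec P (layer (fun w => f (K w)) m))).
by apply/funext => w; rewrite /= {1}gE.
Qed.

Lemma Evar_finite_label_layer (f : I -> 'cV[R]_(N 0%N)) :
  Evar P (layer (fun w => f (K w)) m) @[m --> \oo] --> (0 : R).
Proof.
have [p /andP[p0 p1] pE] := finite_label_energy.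
have sf : sqintv P (fun w => f (K w)).
  by move=> j; exact: (sqint_finite_label (fun i => f i j 0)).
have dec m : Evar P (layer (fun w => f (K w)) m.+1) <=
    (1 - p) * Evar P (layer (fun w => f (K w)) m).
  (* By the energy balance, the claim amounts to [p] times the second moment of layer [m.+1] being
     at most the squared norm of its mean. *)
  rewrite mulrBl mul1r lerBrDr (Evar_layerS m sf) addrC lerD2r -Evar_layerS//.
  rewrite -Ex_sqnorm_layerS.
  have [g gE] := finite_label_layer f m.
  pose h i := cmodW (Wre m) (Wim m) (g i - Evec P (layer (fun w => f (K w)) m)).
  have -> : layer (fun w => f (K w)) m.+1 = fun w => h (K w).
    by apply/funext => w; rewrite /= {1}gE.
  by apply: pE => i j; rewrite mxE sqrtr_ge0.
have geo m : Evar P (layer (fun w => f (K w)) m) <=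
    Evar P (layer (fun w => f (K w)) 0%N) * (1 - p) ^+ m.
  elim: m => [|m ih]; first by rewrite mulr1.
  by rewrite (le_trans (dec m))// exprS mulrCA ler_wpM2l// subr_ge0.
have g0 : geometric (Evar P (layer (fun w => f (K w)) 0%N)) (1 - p) n @[n --> \oo]
    --> (0 : R).
  by apply: cvg_geometric; rewrite ger0_norm ?subr_ge0// ltrBlDr ltrDl.
apply: squeeze_cvgr (cvg_cst 0) g0.
by near=> m; rewrite Evar_ge0 geo.
Unshelve. all: by end_near. Qed.

End finite_label.

(** * Approximation in L^2 by vectors with finitely many values *)

Section approximation.
Variables (n : nat) (X : T -> 'cV[R]_n).
Hypothesis sX : sqintv P X.

(* [value (label M w)] is [X w] clamped to [-(M+1), M+1] and rounded to the
   mesh 1/(M+1), coded by the thresholds lying below each coordinate. *)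
Let L M := (2 * M.+1 ^ 2)%N.
Let thr M (l : nat) : R := l%:R / M.+1%:R - M.+1%:R.
Let label M w : {ffun 'I_n * 'I_(L M) -> bool} :=
  [ffun p : 'I_n * 'I_(L M) => thr M p.2 < X w p.1 0].
Let value M (b : {ffun 'I_n * 'I_(L M) -> bool}) : 'cV[R]_n :=
  \col_i ((\sum_(l < L M) (b (i, l))%:R) / M.+1%:R - M.+1%:R).

Lemma measurable_label M b : measurable (label M @^-1` [set b]).
Proof.
have -> : label M @^-1` [set b] = \bigcap_(p in [set: 'I_n * 'I_(L M)])
    ((fun w => thr M p.2 < X w p.1 0) @^-1` [set b p]).
  apply/seteqP; split => [w /= <- p _|w h]; first by rewrite /= ffunE.
  by apply/ffunP => p; rewrite ffunE; exact: h.
apply: fin_bigcap_measurable; first exact: finite_finset.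
move=> p _; rewrite -[X in measurable X]setTI.
apply: measurable_fun_ltr => //; exact: (sX p.1).1.
Qed.

(** The count is the ceiling of [y] clipped to the interval from 0 to [k]; induction on [k] gives
    just the bounds needed for rounding. *)
Lemma count_lt_bounds (y : R) k : let c := \sum_(l < k) (l%:R < y)%R%:R : R in
  [/\ 0 <= c <= k%:R, 0 <= y -> c <= y + 1, y <= 0 -> c <= 0 & Order.min y k%:R <= c].
Proof.
elim: k => [|k [/andP[c0 ck] cy cy0 yc]] /=.
  by rewrite big_ord0; split => [|y0|//|]; [rewrite lexx|lra|rewrite ge_min lexx orbT].
rewrite big_ord_recr/=; set c := \sum_(l < k) _ in c0 ck cy cy0 yc *.
have kS : k.+1%:R = k%:R + 1 :> R by rewrite -natr1.
rewrite kS; have [ky|yk] := ltP k%:R y; rewrite /= ?addr0.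
  move: yc; rewrite ge_min => /orP yc.
  have kc : k%:R <= c by case: yc => // ?; lra.
  have := ler0n R k; split; [lra|lra|lra|rewrite ge_min; apply/orP; right; lra].
split; [lra|by []|by []|].
move: yc; rewrite !ge_min => /orP[->//|kc].
by apply/orP; left; lra.
Qed.

(** The first bound holds uniformly in [M] and supplies the domination; the second gives pointwise
    convergence, since every point eventually lies in the cube. *)
Lemma valueB M w i : let e := `|X w i 0 - value (label M w) i 0| in
  e <= 1 + `|X w i 0| /\ (`|X w i 0| <= M.+1%:R -> e <= M.+1%:R^-1).
Proof.
set x := X w i 0; set m : R := M.+1%:R.
have m0 : 0 < m by rewrite ltr0n.
have m1 : 1 <= m by rewrite ler1n.
have mV1 : m^-1 <= 1 by rewrite invf_le1.
have mV0 : 0 < m^-1 by rewrite invr_gt0.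
(* Here [y] is the height of [x] above the left end [- m], in units of the mesh [m^-1]; rounding
   replaces [y] by the count [c]. *)
pose y := (x + m) * m.
have LE : (L M)%:R = 2 * m ^+ 2 by rewrite /L natrM natrX.
have xE : x = y / m - m by rewrite /y mulfK ?gt_eqF// addrK.
set c : R := \sum_(l < L M) (l%:R < y)%R%:R.
have vE : value (label M w) i 0 = c / m - m.
  rewrite mxE; congr (_ / _ - _); apply: eq_bigr => l _; rewrite ffunE/= /thr -/x -/m.
  by rewrite ltrBlDr ltr_pdivrMr.
have [/andP[c0 cL] cy cy0 yc] := count_lt_bounds y (L M); rewrite -/c in c0 cL cy cy0 yc.
rewrite vE /=.
have near_x : `|x| <= m -> `|x - (c / m - m)| <= m^-1.
  rewrite ler_norml => /andP[mx xm].
  have y0 : 0 <= y by rewrite mulr_ge0//; lra.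
  have yL : y <= 2 * m ^+ 2 by rewrite /y expr2 mulrA ler_wpM2r//; lra.
  have yc' : y <= c by move: yc; rewrite LE ge_min => /orP[//|]; exact: le_trans.
  rewrite {1}xE (_ : _ - _ = (y - c) / m); last by ring.
  rewrite normrM (gtr0_norm mV0) ger_pMl//.
  by rewrite ler_norml; have := cy y0; lra.
split => //.
have [/near_x h|] := leP `|x| m.
  by rewrite (le_trans h)// (le_trans mV1)// lerDl.
have cm0 : 0 <= c / m by rewrite mulr_ge0// ltW.
have cm2 : c / m <= 2 * m by rewrite ler_pdivrMr// -mulrA -expr2 -LE.
(* Outside the cube the value is the nearer end [m] or [- m], because the count is saturated:
   [c / m] is [2 * m] in the first case and 0 in the second. *)
rewrite ltr_normr => /orP[mx|mx].
  have : 2 * m <= c / m.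
    rewrite ler_pdivlMr// -mulrA -expr2; move: yc; rewrite LE ge_min => /orP[|//].
    by apply: le_trans; rewrite /y expr2 mulrA ler_wpM2r//; lra.
  move: cm0 cm2; set z := c / m => z0 z2 mz.
  by rewrite !ger0_norm; lra.
have c_le0 : c <= 0 by apply: cy0; rewrite /y pmulr_lle0//; lra.
have -> : c = 0 by apply/le_anti; rewrite c_le0.
rewrite mul0r ler_norml; have := ler_norm (- x); rewrite normrN => ?.
by apply/andP; split; lra.
Qed.

Lemma finite_label_approximation (e : R) : 0 < e ->
  exists (I : finType) (K : T -> I) (f : I -> 'cV[R]_n),
    (forall i, measurable (K @^-1` [set i])) /\
    Ex (fun w => sqnorm (X w - f (K w))) <= e.
Proof.
move=> e0.
pose f M w : \bar R := (sqnorm (X w - value (label M w)))%:E.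
(* This dominates the squared error because (1 + |x|)^2 <= 2 + 2 x^2. *)
pose g w : \bar R := (\sum_(i < n) (2 + 2 * X w i 0 ^+ 2))%:E.
have sf M : sqintv P (fun w => X w - value (label M w)).
  apply: sqintvB => // i.
  exact: (sqint_finite_label (@measurable_label M) (fun b => value b i 0)).
have mf M : measurable_fun setT (f M).
  by have := sqnorm_int (sf M) => /integrableP[].
have f0 w : f ^~ w @ \oo --> 0%:E.
  apply: cvg_EFin; first by near=> M.
  have h0 : n%:R * harmonic k @[k --> \oo] --> (0 : R).
    by rewrite -[X in _ --> X](mulr0 n%:R); apply: cvgMl_tmp; exact: cvg_harmonic.
  apply: squeeze_cvgr (cvg_cst 0) h0; near=> M.
  rewrite /= sqnorm_ge0/= /sqnorm mulr_natl -[in X in _ *+ X](card_ord n) -sumr_const.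
  apply: ler_sum => i _; rewrite subvE -real_normK ?num_real//.
  have xM : `|X w i 0| <= M.+1%:R.
    (* The bound |x| <= x^2 + 1 gives one threshold on [M], namely [sqnorm (X w)], that serves all
       coordinates. *)
    rewrite -natr1 (@le_trans _ _ (sqnorm (X w) + 1))//.
      have := coord_sqnorm (X w) i; rewrite -real_normK ?num_real//.
      by have := sqr_ge0 (`|X w i 0| - 1); nra.
    rewrite lerD2r; near: M; exact: nbhs_infty_ger.
  have /(_ xM) le1 := (valueB M w i).2.
  rewrite expr2 (@le_trans _ _ (1 * M.+1%:R^-1)) ?mul1r// -[leRHS]mul1r.
  rewrite ler_pM// (le_trans le1)// invf_le1 ?ltr0n// ler1n//.
have ig : P.-integrable setT g.
  apply: intble_sum => i _; apply: intbleD; first exact: intble_cst.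
  by apply: intbleZ; exact: (sX i).2.
have fg w M : (`|f M w| <= g w)%E.
  rewrite lee_fin ger0_norm ?sqnorm_ge0//; apply: ler_sum => i _.
  rewrite subvE -real_normK ?num_real// -(real_normK (num_real (X w i 0))).
  have a0 := normr_ge0 (X w i 0).
  apply: (@le_trans _ _ ((1 + `|X w i 0|) ^+ 2)); last first.
    by rewrite -subr_ge0 (_ : _ - _ = (`|X w i 0| - 1) ^+ 2) ?sqr_ge0//; ring.
  by rewrite lerXn2r// ?nnegrE ?addr_ge0//; exact: (valueB M w i).1.
have [_ _ ] := dominated_convergence (mu := P) measurableT mf
  (measurable_cst 0%E) (aeW _ (fun w _ => f0 w)) ig (aeW _ (fun w M _ => fg w M)).
rewrite integral0 => /fine_cvg/cvgr_lt/(_ e e0) [M _ /(_ M (leqnn M))] /ltW Me.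
by exists _, (label M), (@value M); split => //; exact: measurable_label.
Unshelve. all: by end_near. Qed.

End approximation.

(** * Vanishing of the variances and the tail sums *)

(** The centred [A] is the centred [B] plus the centred difference, whose variance is at most its
    second moment. *)
Lemma Evar_le_perturb n (A B : T -> 'cV[R]_n) : sqintv P A -> sqintv P B ->
  Evar P A <= 2 * Evar P B + 2 * Ex (fun w => sqnorm (A w - B w)).
Proof.
move=> sA sB; have sAB := sqintvB sA sB.
apply: (@le_trans _ _ (2 * Evar P B + 2 * Evar P (fun w => A w - B w))); last first.
  by rewrite lerD2l ler_pM2l//; exact: Evar_le.
have iB := sqnorm_int (sqintv_center sB); have iAB := sqnorm_int (sqintv_center sAB).
rewrite /Evar -!RintegralZl// -RintegralD//; [|exact: intbleZ..].
apply: le_Rintegral => //.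
- exact: sqnorm_int (sqintv_center sA).
- by apply: intbleD; exact: intbleZ.
move=> w _; have := sqnormD_le (B w - Evec P B)
  (A w - B w - Evec P (fun w => A w - B w)) ltr01.
rewrite invr1 EvecB// addrACA -opprD ![_ + (_ - _)]addrC !subrK.
by rewrite (_ : 1 + 1 = 2).
Qed.

Lemma Evar_layer_cvg0 X : sqintv P X ->
  Evar P (layer X m) @[m --> \oo] --> (0 : R).
Proof.
(* The approximation error and the variance of the approximant both enter with a factor 2, hence the
   quarter. *)
move=> sX; apply/cvgrPdist_le => e e0; have e40 : 0 < e / 4 by rewrite divr_gt0.
have [I [K [f [mK XfK]]]] := finite_label_approximation sX e40.
have sf : sqintv P (fun w => f (K w)).
  by move=> j; exact: (sqint_finite_label mK (fun i => f i j 0)).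
have /cvgr_le/(_ _ e40) fe := Evar_finite_label_layer mK f.
near=> m; rewrite sub0r normrN ger0_norm ?Evar_ge0//.
have := Evar_le_perturb (sqintv_layer m sX) (sqintv_layer m sf).
have := layerB_contraction m sX sf.
have : Evar P (layer (fun w => f (K w)) m) <= e / 4 by near: m.
by move: XfK; lra.
Unshelve. all: by end_near. Qed.

(** The squared norm of each mean is a difference of consecutive variances, so the series
    telescopes, and the remainder tends to 0. *)
Lemma nneseries_sqnorm_Evec X n : sqintv P X ->
  (\sum_(n.+1 <= k <oo) (sqnorm (Evec P (layer X k)))%:E)%E =
  (Evar P (layer X n))%:E.
Proof.
move=> sX.
pose v k := Evar P (layer X k); pose u k := sqnorm (Evec P (layer X k)).
have v0 : v m @[m --> \oo] --> (0 : R) by exact: Evar_layer_cvg0.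
have vS k : v k = u k.+1 + v k.+1 by exact: Evar_layerS.
rewrite -/(v n) -[LHS]/(\sum_(n.+1 <= k <oo) (u k)%:E)%E; move: u v v0 vS => u v v0 vS.
apply: cvg_lim => //; rewrite -(cvg_shiftn n.+1).
have uE m : (\sum_(n.+1 <= k < m + n.+1) (u k)%:E)%E = (v n - v (m + n)%N)%:E.
  elim: m => [|m ih]; first by rewrite add0n big_geq// subrr.
  rewrite addSn big_nat_recr ?leq_addl//= ih -EFinD; congr EFin.
  by rewrite addnS addSn (vS (m + n)%N); ring.
apply: cvg_EFin; first by near=> m; rewrite /= uE.
rewrite (_ : _ \o _ = fun m => v n - v (m + n)%N).
  rewrite -[X in _ --> X]subr0; apply: cvgB; first exact: cvg_cst.
  by rewrite -(cvg_shiftn n) in v0.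
by apply/funext => m; rewrite /= uE.
Unshelve. all: by end_near. Qed.

Lemma Evar_layer_le X m : sqintv P X ->
  Evar P (layer X m) <= Ex (fun w => sqnorm (X w)).
Proof.
move=> sX; elim: m => [|m]; first exact: Evar_le.
by apply: le_trans; rewrite (Evar_layerS m sX) lerDr sqnorm_ge0.
Qed.

End scattering.
Arguments sqintv_layer {d T R P N} Wre Wim {X} m _.

(** * Equality in law, and products of independent variables *)

Section laws.
Context {d : measure_display} {T : measurableType d} {R : realType}.
Variable P : probability T R.

Notation Ex f := (Rintegral P setT f).

(** By change of variables, integrability and expectation are read off from the law on the line. *)
Lemma same_law_integrable (U V : {mfun T >-> R}) :
  (forall A, measurable A -> P (U @^-1` A) = P (V @^-1` A)) ->
  P.-integrable setT (EFin \o V) ->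
  P.-integrable setT (EFin \o U) /\ Ex U = Ex V.
Proof.
move=> UV iV.
have eq_int f : (\int[distribution P U]_y f y = \int[distribution P V]_y f y)%E.
  by apply: eq_measure_integral => A mA _; exact: UV.
have iU : P.-integrable setT (EFin \o U).
  apply/integrableP; split; first exact/measurable_EFinP.
  move/integrableP : iV => [_].
  have mabs : measurable_fun setT (fun x : R => `|x%:E|%E).
    by apply: measurableT_comp => //; exact/measurable_EFinP.
  rewrite -(ge0_integral_distribution V mabs)//.
  by rewrite -eq_int ge0_integral_distribution.
split => //; congr fine.
have mE : measurable_fun setT (EFin : R -> \bar R) by exact/measurable_EFinP.
by rewrite -(integral_distribution mE iU) -(integral_distribution mE iV).
Qed.

(** The joint law agrees with the product of the marginals on rectangles, hence everywhere; Fubini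
    then evaluates the integral of the product of the two coordinates. *)
Lemma Ex_independentM (U V : {mfun T >-> R}) :
  (forall A B, measurable A -> measurable B ->
    P (U @^-1` A `&` V @^-1` B) = (P (U @^-1` A) * P (V @^-1` B))%E) ->
  P.-integrable setT (EFin \o U) -> P.-integrable setT (EFin \o V) ->
  P.-integrable setT (EFin \o (fun w => U w * V w)) ->
  Ex (fun w => U w * V w) = Ex U * Ex V.
Proof.
move=> UV iU iV iUV.
pose m1 := distribution P U; pose m2 := distribution P V.
have mUV : measurable_fun setT (fun w => (U w, V w)).
  exact: measurable_fun_pair.
pose W : {mfun T >-> (R * R)%type} := HB.pack (fun w => (U w, V w))
  (isMeasurableFun.Build _ _ _ _ _ mUV).
have WE A : measurable A -> (m1 \x m2)%E A = distribution P W A.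
  by apply: product_measure_unique => A' B mA' mB; rewrite -UV.
pose f (z : R * R) : \bar R := (z.1 * z.2)%:E.
have mf : measurable_fun setT f.
  by apply/measurable_EFinP; apply: measurable_funM;
    [exact: measurable_fst|exact: measurable_snd].
have eq_int g : (\int[m1 \x m2]_z g z = \int[distribution P W]_z g z)%E.
  by apply: eq_measure_integral => A mA _; exact: WE.
have /integrableP[_ ifW] : (distribution P W).-integrable setT f.
  by apply: integrable_pushforward.
have iff : (m1 \x m2)%E.-integrable setT f.
  by apply/integrableP; split => //; rewrite eq_int.
have mE : measurable_fun setT (EFin : R -> \bar R) by exact/measurable_EFinP.
have im1 : m1.-integrable setT (EFin : R -> \bar R).
  by apply: integrable_pushforward.
have im2 : m2.-integrable setT (EFin : R -> \bar R).
  by apply: integrable_pushforward.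
have eU : (\int[m1]_x x%:E = (Ex U)%:E)%E.
  by rewrite (integral_distribution mE iU) fineK//; exact: integrable_fin_num.
have eV : (\int[m2]_x x%:E = (Ex V)%:E)%E.
  by rewrite (integral_distribution mE iV) fineK//; exact: integrable_fin_num.
have : (\int[P]_w (f \o W) w = (Ex U * Ex V)%:E)%E.
  rewrite -(@integral_distribution _ _ _ _ _ P W f mf iUV) -eq_int -integral12_prod_meas1//.
  rewrite /fubini_F /f/=.
  under eq_integral => x _.
    under eq_integral do rewrite EFinM.
    rewrite integralZl// eV muleC.
    over.
  by rewrite integralZl// eU EFinM muleC.
by move=> /(congr1 fine).
Qed.

End laws.

(** * Layers as a deterministic map of the input *)

Section flow.
Context {R : realType}.
Variables (N : nat -> nat) (Wre Wim : forall m, 'M[R]_(N m.+1, N m)).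
Variable c : forall m, 'cV[R]_(N m).

(** The scattering layers with the centring vectors fixed in advance. With the true expectations as
    [c], a layer is a fixed Borel map of its input, so equality in law and independence pass from
    the inputs to the layers. *)
Fixpoint flow m (x : 'cV[R]_(N 0%N)) : 'cV[R]_(N m) :=
  match m with
  | 0%N => x
  | m'.+1 => cmodW (Wre m') (Wim m') (flow m' x - c m')
  end.

Lemma measurable_flow d' (T' : measurableType d') (X : T' -> 'cV[R]_(N 0%N)) m :
  (forall i, measurable_fun setT (fun w => X w i 0)) ->
  forall i, measurable_fun setT (fun w => flow m (X w) i 0).
Proof.
move=> mX; elim: m => //= m ih; apply: measurable_cmodW => i.
by under eq_fun do rewrite subvE; exact: measurable_funB.
Qed.

(** The generators of [borel_vec], named so that column vectors carry a measurable structure through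
    [g_sigma_algebraType]. *)
Definition boxes n : set (set 'cV[R]_n) :=
  [set B | exists A : 'I_n -> set R,
    (forall i, measurable (A i)) /\ B = [set x : 'cV[R]_n | forall i, A i (x i 0)]].

Lemma measurable_coord n i :
  measurable_fun setT (fun x : g_sigma_algebraType (@boxes n) => x i 0).
Proof.
move=> _ A mA; rewrite setTI; apply: sub_sigma_algebra.
exists (fun j => if j == i then A else setT); split => [j|].
  by case: ifPn.
apply/seteqP; split => x /= h; first by move=> j; case: eqP => // ->.
by have := h i; rewrite eqxx.
Qed.

(** Measurability of the flow is instantiated at the identity map of the space of column vectors
    with its box sigma-algebra. *)
Lemma borel_flow m i (A : set R) : measurable A ->
  borel_vec [set x | A (flow m x i 0)].
Proof.
move=> mA.
have := @measurable_flow _ (g_sigma_algebraType (@boxes (N 0%N))) id m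
  (@measurable_coord _) i measurableT A mA.
by rewrite setTI.
Qed.

End flow.

Lemma layer_flow {d : measure_display} {T : measurableType d} {R : realType}
    (P : probability T R) (N : nat -> nat)
    (Wre Wim : forall m, 'M[R]_(N m.+1, N m)) (X : T -> 'cV[R]_(N 0%N)) m w :
  layer P Wre Wim X m w =
  flow Wre Wim (fun m => Evec P (layer P Wre Wim X m)) m (X w).
Proof. by elim: m => //= m ->. Qed.

(** * Empirical layers compared with independent copies of the true ones *)

Section empirical.
Context {d : measure_display} {T : measurableType d} {R : realType}.
Variables (P : probability T R) (N : nat -> nat).
Variables (Wre Wim : forall m, 'M[R]_(N m.+1, N m)) (X : T -> 'cV[R]_(N 0%N)).
Variables (Pn : nat) (Xs : 'I_Pn -> T -> 'cV[R]_(N 0%N)).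
Hypothesis W_isometric : forall m, isometric_W (Wre m) (Wim m).
Hypothesis sX : sqintv P X.
Hypothesis Pn0 : (0 < Pn)%N.
Hypothesis mXs : forall i, random_vector P (Xs i).
Hypothesis same_law : forall i, same_distribution P (Xs i) X.
Hypothesis indep : independent_vecs P Xs.

Notation Ex f := (Rintegral P setT f).

Let c m : 'cV[R]_(N m) := Evec P (layer P Wre Wim X m).
Let Z m i w : 'cV[R]_(N m) := flow Wre Wim c m (Xs i w).

Let layerZ m w : layer P Wre Wim X m w = flow Wre Wim c m (X w).
Proof. exact: layer_flow. Qed.

Let Pn_neq0 : Pn%:R != 0 :> R. Proof. by rewrite pnatr_eq0 -lt0n. Qed.

(** * Moments of one centred coordinate of the copies *)

Section fixed_coordinate.
Variables (m : nat) (j : 'I_(N m)).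

Let V w := layer P Wre Wim X m w j 0 - c m j 0.
Let U i w := Z m i w j 0 - c m j 0.

Let sV : sqint P V.
Proof.
apply: sqint_ext (sqintv_center (sqintv_layer Wre Wim m sX) j) => w.
by rewrite subvE.
Qed.

Let mU i : measurable_fun setT (U i).
Proof.
have mZ := @measurable_flow _ _ Wre Wim c _ _ _ m (mXs i) j.
exact: (measurable_funB mZ (measurable_cst (c m j 0))).
Qed.

Let shift_preim (A : set R) : measurable A ->
  measurable [set y | A (y - c m j 0)].
Proof.
move=> mA; rewrite -[X in measurable X]setTI.
have mf : measurable_fun setT (fun y : R => y - c m j 0).
  by apply: measurable_funB => //; exact: measurable_id.
exact: (mf measurableT A mA).
Qed.

Let UE i (A : set R) :
  U i @^-1` A = Xs i @^-1` [set x | [set y | A (y - c m j 0)] (flow Wre Wim c m x j 0)].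
Proof. by []. Qed.

Let borelU (A : set R) : measurable A ->
  borel_vec [set x | [set y | A (y - c m j 0)] (flow Wre Wim c m x j 0)].
Proof. by move=> mA; apply: borel_flow; exact: shift_preim. Qed.

Let lawU i (A : set R) : measurable A -> P (U i @^-1` A) = P (V @^-1` A).
Proof.
move=> mA; rewrite UE same_law; last exact: borelU.
by congr (P _); apply/seteqP; split => w /=; rewrite /V layerZ.
Qed.

Let indepU i k (A B : set R) : i != k -> measurable A -> measurable B ->
  P (U i @^-1` A `&` U k @^-1` B) = (P (U i @^-1` A) * P (U k @^-1` B))%E.
Proof.
move=> ik mA mB.
pose S (C : set R) := [set x | [set y | C (y - c m j 0)] (flow Wre Wim c m x j 0)].
(* Joint independence is used with the whole space at every index other than [i] and [k]. *)
pose D l := if l == i then S A else if l == k then S B else setT.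
have bD l : borel_vec (D l).
  rewrite /D; case: ifPn => _; first exact: borelU.
  by case: ifPn => _; [exact: borelU|exact: (borelU measurableT)].
have := indep bD; rewrite (bigD1 i)//= (bigD1 k) 1?eq_sym//=.
rewrite [in X in _ = (_ * (_ * X))%E]big1 => [|l /andP[li lk]]; last first.
  by rewrite /D (negbTE li) (negbTE lk) preimage_setT probability_setT.
rewrite mule1 {2 3}/D eqxx (negbTE (_ : k != i)) 1?eq_sym// eqxx => <-.
congr (P _); apply/seteqP; split => [w [Aw Bw] l _|w h].
  by rewrite /D; case: eqP => [->//|_]; case: eqP => [->//|].
have := h i I; have := h k I; rewrite /D /= !eqxx (negbTE (_ : k != i)) 1?eq_sym//.
Qed.

Let mfun_of (f : T -> R) (mf : measurable_fun setT f) : {mfun T >-> R} :=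
  HB.pack f (isMeasurableFun.Build _ _ _ _ _ mf).

Let EV : Ex V = 0.
Proof.
rewrite /V RintegralB//; [|exact: sqint_int (sqintv_layer Wre Wim m sX j)|exact: intble_cst].
by rewrite Ex_cst -EvecE subrr.
Qed.

(** The variables [U i] and [V] have the same law, and so do their squares, since an event on the
    square is an event on the variable; both moments transfer. *)
Lemma centered_sample_coord i : [/\ sqint P (U i), Ex (U i) = 0 &
  Ex (fun w => U i w ^+ 2) = Ex (fun w => V w ^+ 2)].
Proof.
have mU2 : measurable_fun setT (fun w => U i w ^+ 2) by exact: measurable_funX.
have mV2 : measurable_fun setT (fun w => V w ^+ 2).
  by apply: measurable_funX; exact: sV.1.
have sqr_preim (A : set R) : measurable A -> measurable ((fun y : R => y ^+ 2) @^-1` A).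
  move=> mA; rewrite -[X in measurable X]setTI.
  by have := @measurable_funX _ _ R setT id 2%N; apply.
have [_ EU] := @same_law_integrable _ _ _ P (mfun_of (mU i)) (mfun_of sV.1)
  (lawU i) (sqint_int sV).
have [iU2 EU2] := @same_law_integrable _ _ _ P (mfun_of mU2) (mfun_of mV2)
  (fun A mA => lawU i (sqr_preim A mA)) sV.2.
by split => //; rewrite -EV.
Qed.

Lemma centered_sample_uncorrelated i k : i != k -> Ex (fun w => U i w * U k w) = 0.
Proof.
move=> ik; have [[sUi EUi _] [sUk _ _]] := (centered_sample_coord i, centered_sample_coord k).
have := @Ex_independentM _ _ _ P (mfun_of (mU i)) (mfun_of (mU k))
  (fun A B => indepU ik) (sqint_int sUi) (sqint_int sUk) (sqintM sUi sUk).
by move=> /= ->; rewrite EUi mul0r.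
Qed.

(** In the double sum that expands the square, the off-diagonal terms vanish and the [Pn] diagonal
    ones agree. *)
Lemma Ex_sqr_sum_sample :
  Ex (fun w => (\sum_i U i w) ^+ 2) = Pn%:R * Ex (fun w => V w ^+ 2).
Proof.
have sU i : sqint P (U i) by case: (centered_sample_coord i).
transitivity (Ex (fun w => \sum_i \sum_k U i w * U k w)).
  apply: eq_Rintegral => w _; rewrite expr2 mulr_suml.
  by apply: eq_bigr => i _; rewrite mulr_sumr.
rewrite Ex_sum => [|i _]; last by apply: intble_sum => k _; exact: sqintM.
rewrite (eq_bigr (fun=> Ex (fun w => V w ^+ 2))) => [|i _].
  by rewrite sumr_const card_ord mulr_natl.
rewrite Ex_sum => [|k _]; last exact: sqintM.
rewrite (bigD1 i)//= big1 ?addr0 => [|k ki]; last first.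
  by rewrite centered_sample_uncorrelated// eq_sym.
by case: (centered_sample_coord i) => _ _ <-; apply: eq_Rintegral => w _; rewrite expr2.
Qed.

End fixed_coordinate.

Lemma sqintv_Z m i : sqintv P (Z m i).
Proof.
move=> j; have [sU _ _] := centered_sample_coord j i.
by apply: sqint_ext (sqintD sU (sqint_cst P (c m j 0))) => w; rewrite subrK.
Qed.

Let b m w : 'cV[R]_(N m) := Pn%:R^-1 *: \sum_i Z m i w - c m.

Let sb m : sqintv P (b m).
Proof.
apply: sqintvB; last exact: sqintv_cst.
by apply: sqintvZ; apply: sqintv_sum => i _; exact: sqintv_Z.
Qed.

Lemma Ex_sqnorm_sample_mean m :
  Ex (fun w => sqnorm (b m w)) = Pn%:R^-1 * Evar P (layer P Wre Wim X m).
Proof.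
rewrite Ex_sqnorm// /Evar Ex_sqnorm; last first.
  by apply: sqintv_center; exact: sqintv_layer.
rewrite mulr_sumr; apply: eq_bigr => j _.
transitivity (Ex (fun w => Pn%:R^-1 ^+ 2 * (\sum_i (Z m i w j 0 - c m j 0)) ^+ 2)).
  apply: eq_Rintegral => w _; rewrite /b subvE mxE summxE -exprMn sumrB.
  by rewrite sumr_const card_ord -[c m j 0 *+ _]mulr_natl mulrBr mulKf.
have sU i : sqint P (fun w => Z m i w j 0 - c m j 0) by case: (centered_sample_coord j i).
rewrite RintegralZl//; last first.
  by have [] := @sqint_sum _ _ _ P _ (index_enum 'I_Pn) xpredT _ (fun i _ => sU i).
rewrite Ex_sqr_sum_sample mulrA expr2 mulfVK//; congr (_ * _).
by apply: eq_Rintegral => w _; rewrite subvE.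
Qed.

(** [a] is the effect on sample [i] of centring by sample means in place of expectations; [D] is its
    mean square over the sample. *)
Let a m i w : 'cV[R]_(N m) := emp_layer Wre Wim Xs m i w - Z m i w.
Let D m w := Pn%:R^-1 * \sum_i sqnorm (a m i w).

Let emp_meanB m w :
  emp_mean Wre Wim Xs m w - c m = Pn%:R^-1 *: \sum_i a m i w + b m w.
Proof. by rewrite /a /b sumrB scalerBr addrA subrK. Qed.

Lemma sqintv_emp_layer m i : sqintv P (emp_layer Wre Wim Xs m i).
Proof.
elim: m i => [|m ih] i; first exact: (@sqintv_Z 0%N i).
apply: sqintv_cmodW; apply: sqintvB => //.
by apply: sqintvZ; exact: sqintv_sum.
Qed.

Let sa m i : sqintv P (a m i).
Proof. by apply: sqintvB; [exact: sqintv_emp_layer|exact: sqintv_Z]. Qed.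

Let iD m : P.-integrable setT (EFin \o D m).
Proof. by apply: intbleZ; apply: intble_sum => i _; exact: sqnorm_int. Qed.

(* The centring error of the sample mean enters only once: averaging
   [|a_i - avg a - b|^2] leaves no cross term between [a_i - avg a] and [b]. *)
Lemma empirical_error_step m w : D m.+1 w <= D m w + sqnorm (b m w).
Proof.
have -> : D m w + sqnorm (b m w) =
    Pn%:R^-1 * (\sum_i sqnorm (a m i w) + Pn%:R * sqnorm (b m w)).
  by rewrite mulrDr mulKf.
rewrite ler_wpM2l ?invr_ge0//.
apply: (@le_trans _ _ (\sum_i
  sqnorm (a m i w - Pn%:R^-1 *: \sum_k a m k w - b m w))); last first.
  (* The identity also subtracts [Pn] times the squared norm of the average of [a]; this term is
     discarded. *)
  rewrite sum_sqnormB_avg// lerD2r gerBl mulr_ge0// sqnorm_ge0//.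
apply: ler_sum => i _; apply: le_trans (sqnorm_cmodWB _ _ _) _ => //.
have -> : a m i w - Pn%:R^-1 *: \sum_k a m k w - b m w =
    a m i w - (emp_mean Wre Wim Xs m w - c m).
  by rewrite emp_meanB; move: (b m w) (a m i w) => x y; rewrite opprD addrA.
by rewrite -/(Z m i w) (opprD (Z m i w)) addrACA -opprD.
Qed.

(** The one-step bounds are summed; the error starts at 0 because both recursions begin with the
    sample itself. *)
Lemma Ex_empirical_error m :
  Ex (D m) <= Pn%:R^-1 * \sum_(n < m) Evar P (layer P Wre Wim X n).
Proof.
elim: m => [|m ih].
  rewrite big_ord0 mulr0 -[leRHS](Ex_cst P); apply: le_Rintegral => //.
  - exact: iD.
  - exact: intble_cst.
  by move=> w _; rewrite /D big1 ?mulr0// => i _; rewrite /a/= subrr /sqnorm big1// => ? _;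
    rewrite mxE expr0n.
rewrite big_ord_recr/= mulrDr -Ex_sqnorm_sample_mean.
apply: le_trans (lerD ih (lexx _)); have [iDm ib] := (iD m, sqnorm_int (@sb m)); rewrite -RintegralD//.
apply: le_Rintegral => //; [exact: iD|exact: intbleD|].
by move=> w _; exact: empirical_error_step.
Qed.

Lemma sqintv_emp_meanB m : sqintv P (fun w => emp_mean Wre Wim Xs m w - c m).
Proof.
apply: sqintvB; last exact: sqintv_cst.
by apply: sqintvZ; apply: sqintv_sum => i _; exact: sqintv_emp_layer.
Qed.

(** The error of the empirical mean is the average of [a] plus [b], and convexity bounds the former
    by [D]. The weight [t] stays free: optimising it later yields the L^2 triangle inequality. *)
Lemma Ex_emp_mean_le m (t : R) : 0 < t ->
  Ex (fun w => sqnorm (emp_mean Wre Wim Xs m w - c m)) <=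
  (1 + t) * (Pn%:R^-1 * \sum_(n < m) Evar P (layer P Wre Wim X n)) +
  (1 + t^-1) * (Pn%:R^-1 * Evar P (layer P Wre Wim X m)).
Proof.
move=> t0; rewrite -Ex_sqnorm_sample_mean.
have t1 : 0 <= 1 + t by rewrite addr_ge0// ltW.
apply: le_trans (lerD (ler_wpM2l t1 (Ex_empirical_error m)) (lexx _)).
have [iDm ib] := (iD m, sqnorm_int (@sb m)).
rewrite -!RintegralZl// -RintegralD//; [|exact: intbleZ..].
apply: le_Rintegral => //; [exact: sqnorm_int (@sqintv_emp_meanB m)| |].
  by apply: intbleD; exact: intbleZ.
move=> w _; rewrite emp_meanB; apply: le_trans (sqnormD_le _ _ t0) _.
by rewrite lerD2r ler_wpM2l//; exact: sqnorm_avg_le.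
Qed.

End empirical.

(* The minimum over [t] is attained at [t = v / u]; [u] or [v] may vanish,
   whence the shift by [e]. *)
Lemma sqr_add_envelope (R : realType) (E u v : R) : 0 <= u -> 0 <= v ->
  (forall t, 0 < t -> E <= (1 + t) * u ^+ 2 + (1 + t^-1) * v ^+ 2) ->
  E <= (u + v) ^+ 2.
Proof.
move=> u0 v0 h; rewrite leNgt; apply/negP => lt_E.
have E0 : 0 <= E by rewrite ltW// (le_lt_trans (sqr_ge0 _) lt_E).
pose r := Num.sqrt E; have rE : r ^+ 2 = E by rewrite sqr_sqrtr.
have ltr : u + v < r.
  by rewrite -(@ltr_pXn2r _ 2) ?nnegrE ?addr_ge0 ?sqrtr_ge0// rE.
(* With a quarter of the gap, shifting both [u] and [v] by [e] keeps the sum [u + v + 2 * e] below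
   [r]. *)
pose e := (r - (u + v)) / 4.
have e0 : 0 < e by rewrite divr_gt0// subr_gt0.
have ue0 : 0 < u + e by lra.
have ve0 : 0 < v + e by lra.
have := h ((v + e) / (u + e)) (divr_gt0 ve0 ue0).
apply/negP; rewrite -ltNge -rE.
apply: (@le_lt_trans _ _ ((u + v + 2 * e) ^+ 2)); last first.
  by rewrite ltr_pXn2r// ?nnegrE; rewrite /e; lra.
rewrite invf_div.
have -> : (u + v + 2 * e) ^+ 2 = (1 + (v + e) / (u + e)) * (u + e) ^+ 2 +
    (1 + (u + e) / (v + e)) * (v + e) ^+ 2.
  by field; rewrite !gt_eqF.
have mono (x y z : R) : 0 <= x -> 0 < y -> 0 < z ->
    (1 + z / y) * x ^+ 2 <= (1 + z / y) * (x + e) ^+ 2.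
  move=> x0 y0 z0; have k0 : 0 <= 1 + z / y by rewrite addr_ge0// divr_ge0// ltW.
  by rewrite ler_wpM2l// lerXn2r ?nnegrE//; lra.
by rewrite lerD ?mono.
Qed.

(** The omitted cross terms are nonnegative. This serves to replace the root of a sum of variances
    by the sum of their roots. *)
Lemma sum_sqr_le_sqr_sum (R : realType) (s : nat -> R) m :
  (forall n, 0 <= s n) -> \sum_(n < m) s n ^+ 2 <= (\sum_(n < m) s n) ^+ 2.
Proof.
move=> s0; elim: m => [|m ih]; first by rewrite !big_ord0 expr0n.
rewrite !big_ord_recr/= sqrrD lerD2r (le_trans ih)// lerDl mulrn_wge0//.
by rewrite mulr_ge0// sumr_ge0.
Qed.

Theorem theorem2 (d : measure_display) (T : measurableType d) (R : realType)
  (P : probability T R) (N : nat -> nat)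
  (Wre Wim : forall m, 'M[R]_(N m.+1, N m)) (X : T -> 'cV[R]_(N 0%N))
  (Pn : nat) (Xs : 'I_Pn -> T -> 'cV[R]_(N 0%N)) :
  (forall m, (0 < N m)%N) ->
  (forall m, isometric_W (Wre m) (Wim m)) ->
  random_vector P X ->
  ('E_P[fun w => sqnorm (X w)] < +oo)%E ->
  (0 < Pn)%N ->
  (forall i, random_vector P (Xs i)) ->
  (forall i, same_distribution P (Xs i) X) ->
  independent_vecs P Xs ->
  forall m : nat,
    ('E_P[fun w => sqnorm (emp_mean Wre Wim Xs m w - Evec P (layer P Wre Wim X m))]
     <= (Pn%:R^-1)%:E *
        (\sum_(0 <= n < m.+1)
            sqrte (\sum_(n.+1 <= k <oo) (sqnorm (Evec P (layer P Wre Wim X k)))%:E)) ^+ 2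
     /\
     (Pn%:R^-1)%:E *
        (\sum_(0 <= n < m.+1)
            sqrte (\sum_(n.+1 <= k <oo) (sqnorm (Evec P (layer P Wre Wim X k)))%:E)) ^+ 2
     <= ((m.+1%:R ^+ 2 / Pn%:R)%:E * 'E_P[fun w => sqnorm (X w)]))%E.
Proof.
move=> _ W1 mX EX2 Pn0 mXs same_law indep m.
have sX : sqintv P X.
  have msq : measurable_fun setT (fun w => sqnorm (X w)).
    by apply: measurable_sum => i; apply: measurable_funX; exact: mX.
  have isq : P.-integrable setT (EFin \o (fun w => sqnorm (X w))).
    apply/integrableP; split; first exact/measurable_EFinP.
    under eq_integral do rewrite /= ger0_norm ?sqnorm_ge0//.
    by move: EX2; rewrite unlock.
  move=> i; split; first exact: mX.
  apply: intble_le isq; first by apply: measurable_funX; exact: mX.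
  by move=> w; rewrite ger0_norm ?sqr_ge0// coord_sqnorm.
pose s n := Num.sqrt (Evar P (layer P Wre Wim X n)).
have s0 n : 0 <= s n by exact: sqrtr_ge0.
have s2 n : s n ^+ 2 = Evar P (layer P Wre Wim X n) by rewrite sqr_sqrtr// Evar_ge0.
(* Each inner tail sum is the variance of layer [n], so its extended square root is the finite
   number [s n]. *)
have -> : (\sum_(0 <= n < m.+1)
    sqrte (\sum_(n.+1 <= k <oo) (sqnorm (Evec P (layer P Wre Wim X k)))%:E) =
    (\sum_(n < m.+1) s n)%:E)%E.
  rewrite big_mkord -sumEFin; apply: eq_bigr => n _.
  by rewrite nneseries_sqnorm_Evec.
have Pn0' : 0 < Pn%:R :> R by rewrite ltr0n.
rewrite (expectation_EFin (sqnorm_int sX)).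
have smean : sqintv P (fun w => emp_mean Wre Wim Xs m w - Evec P (layer P Wre Wim X m)).
  exact: (sqintv_emp_meanB Wre Wim sX mXs same_law).
rewrite (expectation_EFin (sqnorm_int smean)).
rewrite -EFin_expe -!EFinM !lee_fin; split.
  (* The factor [Pn%:R^-1] is absorbed as [q ^+ 2]; the envelope is applied to [q] times the sum of
     [s n] over [n < m], and to [q * s m]. *)
  pose q := Num.sqrt (Pn%:R^-1 : R).
  have q2 : q ^+ 2 = Pn%:R^-1 by rewrite sqr_sqrtr// invr_ge0 ltW.
  have q0 : 0 <= q by exact: sqrtr_ge0.
  rewrite big_ord_recr/= -q2 -exprMn mulrDr; apply: sqr_add_envelope.
  - by rewrite mulr_ge0// sumr_ge0.
  - by rewrite mulr_ge0.
  move=> t t0; apply: le_trans (Ex_emp_mean_le W1 sX Pn0 mXs same_law indep m t0) _.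
  rewrite !exprMn q2 s2 lerD2r ler_wpM2l ?addr_ge0 ?(ltW t0)//.
  rewrite ler_wpM2l ?invr_ge0 ?(ltW Pn0')//.
  apply: le_trans (sum_sqr_le_sqr_sum m s0).
  by apply: ler_sum => n _; rewrite s2.
(* For the second bound, each of the [m.+1] terms [s n] is at most the root of the second moment of
   [X]. *)
rewrite [leRHS]mulrAC [leRHS]mulrC ler_wpM2l ?invr_ge0 ?(ltW Pn0')//.
set E := Rintegral _ _ _.
have E0 : 0 <= E by apply: Rintegral_ge0 => w _; exact: sqnorm_ge0.
rewrite -(sqr_sqrtr E0) -exprMn lerXn2r ?nnegrE ?sumr_ge0 ?mulr_ge0 ?sqrtr_ge0//.
rewrite mulr_natl -[in X in _ *+ X](card_ord m.+1) -sumr_const.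
by apply: ler_sum => n _; rewrite ler_wsqrtr// Evar_layer_le.
Qed.
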